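(* Every Eulerian digraph $G$ on $n$ vertices with maximum degree $\Delta$ can be decomposed into $O(n\log\Delta)$ edge-disjoint cycles.
   Context: Digraphs are finite, without loops and without parallel edges; each edge is an ordered pair $(u,v)$ of distinct vertices, and both $(u,v)$ and $(v,u)$ may be present. $\mathrm{d}^+(v)$ and $\mathrm{d}^-(v)$ denote the out-degree and in-degree of $v$. The maximum degree of $G$ is $\Delta=\Delta(G):=\max_{v\in V(G)}\{\mathrm{d}^-(v),\mathrm{d}^+(v)\}$. A digraph is Eulerian if it is connected and $\mathrm{d}^+(v)=\mathrm{d}^-(v)$ for every vertex $v$. Cycles are directed cycles without repeated vertices (length $2$ is allowed). $\log$ is the natural logarithm. A decomposition into cycles is a collection of pairwise edge-disjoint cycles whose edge sets have union $E(G)$. The constant implied by $O(\cdot)$ is absolute.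
   Formalization: The bound is proved with log(max(2, Δ)) in place of log Δ: for Δ = 1 (a single directed cycle) log Δ = 0 although one cycle is needed, and for Δ = 0 the logarithm is undefined; for Δ ≥ 2 nothing changes. *)

(* Defs.v *)
From mathcomp Require Import all_boot all_order all_algebra.
From mathcomp Require Import reals exp.

Set Implicit Arguments.
Unset Strict Implicit.
Unset Printing Implicit Defensive.

(* A digraph on the finite vertex type [T] is a relation [e : rel T]; "no
   loops" is [irreflexive e], and parallel edges cannot occur. *)

Definition edges (T : finType) (e : rel T) : {set T * T} :=
  [set p | e p.1 p.2].

Definition outdeg (T : finType) (e : rel T) (v : T) : nat := #|[set w | e v w]|.

Definition indeg (T : finType) (e : rel T) (v : T) : nat := #|[set u | e u v]|.

Definition max_degree (T : finType) (e : rel T) : nat :=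
  \max_(v : T) maxn (indeg e v) (outdeg e v).

(* Connectedness of the underlying undirected graph. *)
Definition connected_digraph (T : finType) (e : rel T) : Prop :=
  forall x y : T, connect [rel u v | e u v || e v u] x y.

Definition eulerian (T : finType) (e : rel T) : Prop :=
  connected_digraph e /\ (forall v : T, outdeg e v = indeg e v).

(* A directed cycle is the duplicate-free sequence of its vertices in cyclic
   order; the last vertex is joined back to the first. The empty sequence
   satisfies [ucycle] and must be excluded; singletons are loops, hence
   impossible when [e] is irreflexive. *)
Definition is_dicycle (T : finType) (e : rel T) (c : seq T) : Prop :=
  c <> [::] /\ ucycle e c.

Definition cycle_edges (T : finType) (c : seq T) : {set T * T} :=
  [set (x, next c x) | x in c].

(* [size D] is the number of cycles: no cycle is counted twice, not even up to
   rotation, because edge sets of cycles are nonempty and those at distinct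
   positions of [D] are disjoint. *)
Definition cycle_decomposition (T : finType) (e : rel T) (D : seq (seq T)) :
    Prop :=
  [/\ forall c : seq T, c \in D -> is_dicycle e c,
      pairwise (fun c c' => [disjoint cycle_edges c & cycle_edges c']) D
    & \bigcup_(c <- D) cycle_edges c = edges e].

(* Main.v *)
Require Import Defs.
From mathcomp Require Import all_boot all_order all_algebra.
From mathcomp Require Import reals exp.
From mathcomp Require Import zify ring lra.

Set Implicit Arguments.
Unset Strict Implicit.
Unset Printing Implicit Defensive.

(* Let Phi = sum_v d(v)^2. Some cycle C satisfies 4 n sum_{v in C} d(v) >= Phi.
   To see this, run a depth-first search. For each vertex b let A_b be the set
   of vertices reachable from b without meeting its proper tree ancestors, and
   W_b the part of the tree path to b that starts at the highest ancestor with an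
   in-neighbour in A_b. If W_b is nonempty, then W_b and b lie on a common cycle.
   All edges leaving A_b end in W_b, so by balance at most sum_{W_b} d edges enter
   A_b. Fix x, with k in-neighbours that are its descendants and r others. If w
   is one of the k then x is in W_w; if w, w' are two of the r, then x lies in A_w
   and A_w', and w' is not in A_w or w is not in A_w'. Summing over x, the edges
   entering the sets A_b number at least sum r^2 / 2, while sum_b sum_{W_b} d is
   at least sum d k; since d = k + r this gives Phi <= 4 sum_b sum_{W_b} d.
   Removing such a cycle lowers Phi by t >= max(1, Phi / 4n), hence
   ln(n + Phi) by at least t / (n + Phi) >= 1 / 5n, and
   ln(n + Phi) - ln n <= 3 ln(max(2, Delta)) initially. *)

(** * Depth-first search forests *)

Section DFS.
Variables (T : finType) (e : rel T).
Implicit Types (U X : {set T}) (b c v z : T).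

(* Every vertex of [U] is reachable from [X0] inside [U]. *)
Definition generates U X0 := forall X : {set T}, X0 \subset X ->
  (forall v z, v \in U -> v \in X -> z \in U -> e v z -> z \in X) -> U \subset X.

(* [s b] is the list of proper ancestors of [b] in a depth-first forest on [U]
   with roots in [X0], and [I b] the set of vertices finished no later than [b]. *)
Definition search_forest U X0 (s : T -> seq T) (I : T -> {set T}) :=
  [/\ forall b, b \in U ->
        [/\ uniq (rcons (s b) b), sorted e (rcons (s b) b),
            head b (s b) \in X0 & {subset s b <= U}],
      forall b, b \in U ->
        [/\ b \in I b, I b \subset U & forall v, v \in I b -> v \notin s b],
      forall b v z, b \in U -> v \in I b -> z \in U -> e v z ->
        (z \in I b) || (z \in s b)
    & forall b c, b \in U -> c \in U -> b \in I c -> c \in I b -> b = c].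

(** Induction on the size of [U]. A root [c] is taken in [X0], and [Rc] is what it reaches inside
    [U]. One search treats [Rc] without [c], starting from the out-neighbours of [c]; a later one
    treats the rest of [U], still starting from [X0]. No edge inside [U] leaves [Rc], so the two
    forests can be glued. *)
Lemma search_forest_exists U X0 : irreflexive e -> generates U X0 ->
  exists s I, search_forest U X0 s I.
Proof.
move=> irr_e; have [k] := ubnP #|U|; elim: k U X0 => // k IHk U X0 leUk genU.
(* If [U] misses [X0], the complement of [U] contains [X0] and is trivially closed, so [generates]
   forces [U] to be empty. *)
have [U0 | [c cU cX0]] : U = set0 \/ exists2 c, c \in U & c \in X0.
- have [/existsP[c /andP[cU cX]]|] := boolP [exists c, (c \in U) && (c \in X0)].
    by right; exists c.
  rewrite negb_exists => /forallP noc; left; apply/setP=> v; rewrite inE.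
  apply/negP=> vU; have /subsetP/(_ v vU) : U \subset ~: U; last first.
    by rewrite inE vU.
  apply: genU => [|w z wU]; last by rewrite inE wU.
  apply/subsetP=> w wX0; rewrite inE.
  by apply/negP=> wU; have := noc w; rewrite wU wX0.
- by exists (fun=> [::]), (fun=> set0); rewrite U0; split=> [b|b|b v z|b d]; rewrite inE.
pose rU := [rel v z | [&& v \in U, z \in U & e v z]].
pose Rc := [set v | connect rU c v].
have cR : c \in Rc by rewrite inE connect0.
have RU : Rc \subset U.
  apply/subsetP=> v; rewrite inE => /connectP[p].
  by case/lastP: p => [_ ->//|p y]; rewrite rcons_path last_rcons => /andP[_ /and3P[_ yU _]] ->.
have stepR v z : v \in Rc -> z \in U -> e v z -> z \in Rc.
  move=> vR zU vz; have vU := subsetP RU v vR.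
  move: vR; rewrite !in_set => cv; apply: connect_trans cv _.
  by apply: connect1; rewrite /= vU zU.
pose U1 := Rc :\ c; pose U2 := U :\: Rc.
have [||s1 [I1 [path1 I1P clo1 anti1]]] := IHk U1 [set z | e c z].
- rewrite -ltnS (leq_trans _ leUk) // ltnS (leq_trans _ (subset_leq_card RU)) //.
  by rewrite (cardsD1 c Rc) cR.
(* A path from [c] stays in [c |: X]: a step out of [c] lands in [X] because [X] contains the
   out-neighbours of [c], and any other step by closure, unless it returns to [c]. *)
- move=> X E1X cloX; apply/subsetP=> v; rewrite !inE => /andP[nvc /connectP[p]].
  suff main a : a \in Rc -> a \in c |: X -> path rU a p -> v = last a p -> v \in X.
    by apply: main => //; rewrite in_setU1 eqxx.
  elim: p a => [a _|y p IHp a aR aX /=].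
    by move=> aX _ /= va; move: aX; rewrite -va in_setU1 (negPf nvc).
  case/andP=> /and3P[aU yU ay] yp; apply: IHp => //; first exact: stepR ay.
  rewrite in_setU1; case: eqVneq => //= nyc; move: aX; rewrite in_setU1.
  have [ac _|nac aX] := eqVneq a c.
    by apply: (subsetP E1X); rewrite inE -ac.
  have yR := stepR a y aR yU ay.
  by apply: (cloX a y) => //; rewrite in_setD1 ?nac ?nyc.
have [||s2 [I2 [path2 I2P clo2 anti2]]] := IHk U2 X0.
- rewrite -ltnS (leq_trans _ leUk) // ltnS proper_card //.
  rewrite properE subsetDl; apply/subsetPn; exists c => //.
  by rewrite in_setD cR.
(* If [X] is closed in [U2], then [X :|: Rc] is closed in [U]. *)
- move=> X E0X cloX; suff /subsetP sU : U \subset X :|: Rc.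
    by apply/subsetP=> v /setDP[vU vR]; have:= sU v vU; rewrite in_setU (negPf vR) orbF.
  apply: genU => [|v z vU vXR zU vz]; first by rewrite (subset_trans E0X) ?subsetUl.
  rewrite in_setU; have [vR|vR] := boolP (v \in Rc).
    by rewrite (stepR v z) ?orbT.
  have [zR|zR] := boolP (z \in Rc); first by rewrite orbT.
  rewrite orbF; apply: cloX vz; rewrite ?in_setD ?vR ?zR //.
  by move: vXR; rewrite in_setU (negPf vR) orbF.
(* [c] becomes the topmost ancestor throughout [U1], and all of [Rc] finishes before [U2]. The last
   branch serves [c] itself: no ancestors, and finished last in [Rc]. *)
pose s b := if b \in U1 then c :: s1 b else if b \in U2 then s2 b else [::].
pose I b := if b \in U1 then I1 b else if b \in U2 then Rc :|: I2 b else Rc.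
have c1 : c \notin U1 by rewrite !inE eqxx.
have U12 v : v \in U2 -> v \notin U1 by rewrite !in_setD => /andP[/negPf->]; rewrite andbF.
have Ucase b : b \in U -> [\/ b \in U1, b = c | b \in U2].
  move=> bU; have [->|nbc] := eqVneq b c; first by constructor 2.
  by have [bR|bR] := boolP (b \in Rc); [constructor 1|constructor 3]; rewrite in_setD ?bU ?bR // inE nbc.
have sc : s c = [::] by rewrite /s (negPf c1) in_setD cR.
have Ic : I c = Rc by rewrite /I (negPf c1) in_setD cR.
have s1E b : b \in U1 -> s b = c :: s1 b by rewrite /s => ->.
have I1E b : b \in U1 -> I b = I1 b by rewrite /I => ->.
have s2E b : b \in U2 -> s b = s2 b by move=> b2; rewrite /s b2 (negPf (U12 b b2)).
have I2E b : b \in U2 -> I b = Rc :|: I2 b by move=> b2; rewrite /I b2 (negPf (U12 b b2)).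
have U1R b : b \in U1 -> b \in Rc by case/setD1P.
have U2N b : b \in U2 -> b \notin Rc by case/setDP.
have U1U b : b \in U1 -> b \in U by move/U1R; apply: (subsetP RU).
have U2U b : b \in U2 -> b \in U by case/setDP.
exists s, I; split.
- move=> b /Ucase[b1|->|b2].
  + rewrite s1E //; have [u1 p1 h1 sub1] := path1 b b1; split=> //=.
    * rewrite u1 andbT mem_rcons inE negb_or eq_sym; case/setD1P: (b1) => -> _ /=.
      by apply/negP=> /sub1; rewrite (negPf c1).
    * by move: p1 h1; case: (s1 b) => [|h t] /=; rewrite inE => p1 -> .
    * by move=> v; rewrite inE => /orP[/eqP->//|/sub1/U1U].
  + by rewrite sc; split.
  + rewrite s2E //; have [u2 p2 h2 sub2] := path2 b b2; split=> //.
    by move=> v /sub2/U2U.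
- move=> b /Ucase[b1|->|b2].
  + rewrite s1E // I1E //; have [bI /subsetP sI dI] := I1P b b1; split=> //.
      by apply/subsetP=> v /sI/U1U.
    move=> v vI; rewrite inE negb_or dI // andbT.
    by apply: contraNneq c1 => <-; apply: sI.
  + by rewrite sc Ic.
  + rewrite s2E // I2E //; have [bI sI dI] := I2P b b2; split.
    * by rewrite in_setU bI orbT.
    * by rewrite subUset RU (subset_trans sI) ?subsetDl.
    * move=> v; rewrite in_setU => /orP[vR|/dI//].
      by have [_ _ _ sub2] := path2 b b2; apply/negP=> /sub2/U2N; rewrite vR.
- move=> b v z /Ucase[b1|->|b2].
  + rewrite s1E // I1E // => vI zU vz; have [_ /subsetP sI _] := I1P b b1.
    have zR := stepR v z (U1R _ (sI v vI)) zU vz.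
    have [->|nzc] := eqVneq z c; first by rewrite mem_head orbT.
    by rewrite in_cons (negPf nzc); apply: clo1 vz => //; rewrite in_setD1 nzc.
  + by rewrite sc Ic => vR zU vz; rewrite (stepR v z).
  + rewrite s2E // I2E // !in_setU => vI zU vz.
    have [//|zR] := boolP (z \in Rc); have [vR|vR] := boolP (v \in Rc).
      by rewrite (stepR v z) in zR.
    by rewrite (negPf vR) /= in vI; apply: clo2 vz => //; rewrite in_setD zR.
- move=> b d /Ucase[b1|->|b2] /Ucase[d1|->|d2] //.
  + by rewrite !I1E //; apply: anti1.
  + by rewrite (I1E b) // => _ cI; have [_ /subsetP sI _] := I1P b b1; have:= sI c cI; rewrite (negPf c1).
  + by rewrite (I1E b) // => _ dI; have [_ /subsetP sI _] := I1P b b1; have:= U12 d d2; rewrite sI.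
  + by rewrite (I1E d) // => cI _; have [_ /subsetP sI _] := I1P d d1; have:= sI c cI; rewrite (negPf c1).
  + by rewrite Ic => _ dR; have := U2N d d2; rewrite dR.
  + by rewrite (I1E d) // => bI _; have [_ /subsetP sI _] := I1P d d1; have:= U12 b b2; rewrite sI.
  + by rewrite Ic => bR; have := U2N b b2; rewrite bR.
  + rewrite !I2E // !in_setU (negPf (U2N b b2)) (negPf (U2N d d2)) /=.
    exact: anti2.
Qed.
End DFS.

(** * Cycles of large total degree in balanced digraphs *)

Section HeavyCycle.
Variables (T : finType) (e : rel T).
Hypothesis irr_e : irreflexive e.
Hypothesis bal_e : forall v, outdeg e v = indeg e v.

Lemma outdeg_sum v : outdeg e v = \sum_w e v w.
Proof. by rewrite /outdeg -sum1dep_card big_mkcond; apply: eq_bigr => w _; case: (e v w). Qed.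

Lemma indeg_sum v : indeg e v = \sum_w e w v.
Proof. by rewrite /indeg -sum1dep_card big_mkcond; apply: eq_bigr => w _; case: (e w v). Qed.

(** Out-degrees and in-degrees have equal sums over [X], and the edges inside [X] count once in
    each. *)
Lemma balanced_cut (X : {set T}) :
  \sum_(x in X) \sum_(w | w \notin X) e w x = \sum_(x in X) \sum_(w | w \notin X) e x w.
Proof.
have: \sum_(x in X) outdeg e x = \sum_(x in X) indeg e x by apply: eq_bigr.
under eq_bigr do rewrite outdeg_sum (bigID (mem X)) /=.
under [RHS]eq_bigr do rewrite indeg_sum (bigID (mem X)) /=.
by rewrite !big_split /= exchange_big /= => /addnI.
Qed.

(** Meant for [p] the lower end of the tree path to [b] and [q] a walk on from [b] off that path,
    whose end has an edge back to the start of [p]. *)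
Lemma is_dicycle_close (p q : seq T) b :
  p != [::] -> uniq (p ++ b :: q) -> sorted e (rcons p b) -> path e b q ->
  e (last b q) (head b p) -> is_dicycle e (p ++ b :: q).
Proof.
case: p => // a p _ u /= pab bq ea; split=> //; rewrite /ucycle u andbT /=.
by rewrite rcons_cat cat_path /= rcons_path bq ea !andbT -rcons_path.
Qed.

Lemma path_andr (P : pred T) a q :
  path [rel v z | e v z && P z] a q = path e a q && all P q.
Proof. by elim: q a => //= y q IHq a; rewrite IHq andbACA. Qed.

Lemma sum_sqr_outdeg_le : exists W : T -> seq T,
  (forall b, W b != [::] -> exists2 c, is_dicycle e c &
     \sum_(v in W b) outdeg e v <= \sum_(v in c) outdeg e v) /\
  \sum_v outdeg e v ^ 2 <= 4 * \sum_b \sum_(v in W b) outdeg e v.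
Proof.
have [|s [I [pathS IP cloI antiI]]] := @search_forest_exists T e setT setT irr_e.
  by move=> X.
(* [A b] and [W b] are the sets A_b and W_b of the overview. When no ancestor has an in-neighbour in
   [A b], [find] returns the length of [s b] and [W b] is empty. *)
pose off b := [rel v z | e v z && (z \notin s b)].
pose A b := [set v | connect (off b) b v].
pose ex b z := [exists v in A b, e v z].
pose W b := drop (find (ex b) (s b)) (s b).
have selfA b : b \in A b by rewrite inE connect0.
(* By [cloI], a path from [b] that avoids the ancestors of [b] cannot leave [I b]. Through this
   inclusion the antisymmetry of [I] passes to [A]. *)
have AI b v : v \in A b -> v \in I b.
  have [bI _ _] := IP b (in_setT b).
  rewrite inE => /connectP[p bp ->]; elim: p {1 4 5}b bI bp => //= y p IHp a aI.
  case/andP=> /andP[ay ys]; apply: IHp.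
  by have:= cloI b a y (in_setT _) aI (in_setT _) ay; rewrite (negPf ys) orbF.
have stepA b v z : v \in A b -> e v z -> z \notin s b -> z \in A b.
  rewrite !in_set => bv vz zs; apply: connect_trans bv _.
  by apply: connect1; rewrite /= vz.
have WP b z : z \in s b -> ex b z -> z \in W b.
  move=> zs exz; rewrite -(cat_take_drop (find (ex b) (s b)) (s b)) mem_cat in zs.
  case/orP: zs => // /(nthP z)[i]; rewrite size_take => ilt zi.
  have i_lt : i < find (ex b) (s b) by case: ifP ilt => // h h'; apply: leq_trans h' _; rewrite leqNgt h.
  by move: zi; rewrite nth_take // => zi; have := before_find z i_lt; rewrite zi exz.
have outA b v z : v \in A b -> e v z -> z \notin A b -> z \in W b.
  move=> vA vz zA; apply: WP; last by apply/existsP; exists v; rewrite vA.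
  by apply: contraNT zA => /(stepA b v z vA vz).
exists W; split.
- move=> b Wn0; have [us ps _ _] := pathS b (in_setT _).
  have sE := cat_take_drop (find (ex b) (s b)) (s b); rewrite -/(W b) in sE.
  have hasx : has (ex b) (s b).
    by rewrite has_find ltnNge; apply: contra Wn0 => h; rewrite /W drop_oversize.
  have /existsP[v /andP[vA vh]] : ex b (head b (W b)).
    have := nth_find b hasx; rewrite -nth0 /W nth_drop addn0.
    by [].
  move: vA; rewrite inE => /connectP[q0 /shortenP[q bq uq _] vq].
  have /andP[{}bq /allP offq] : path e b q && all (fun z => z \notin s b) q.
    by rewrite -path_andr.
  have [bs uW] : b \notin s b /\ uniq (W b).
    by move: us; rewrite rcons_uniq => /andP[-> us]; rewrite drop_uniq.
  (* The cycle descends the tree along [W b] to [b], follows [q] off the ancestors to [v], and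
     returns by the edge from [v] to the head of [W b]. *)
  exists (W b ++ b :: q); last first.
    rewrite big_mkcond [leqRHS]big_mkcond leq_sum // => z _.
    by rewrite mem_cat; case: (z \in W b).
  apply: is_dicycle_close => //; last by rewrite -vq.
    rewrite cat_uniq uW uq andbT; apply/hasPn => z zbq; apply/negP=> /mem_drop zs.
    by move: zbq; rewrite inE => /orP[/eqP zb|/offq]; [rewrite zb (negPf bs) in zs|rewrite zs].
  by rewrite -drop_rcons ?drop_sorted // ltnW // -has_find.
(* [k x] and [#|O x|] are k and r of the overview; [cin x] counts the pairs of a set [A b]
   containing [x] and an edge entering it at [x]. *)
- pose d v := outdeg e v; pose k x := #|[set w | e w x && (x \in s w)]|.
  pose O x := [set w | e w x && (x \notin s w)].
  pose cin x := \sum_b \sum_(w | w \notin A b) (x \in A b) * e w x.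
  have dE x : d x = k x + #|O x|.
    rewrite /d bal_e /indeg -(cardsID [set w | x \in s w]); congr (_ + _).
      by apply: eq_card => w; rewrite !inE.
    by apply: eq_card => w; rewrite !inE andbC.
  (* Each in-neighbour [w] of [x] with [x] among its ancestors puts [x] into [W w], since [w] lies
     in [A w]. *)
  have lower1 : \sum_x d x * k x <= \sum_b \sum_(v in W b) d v.
    under [leqRHS]eq_bigr do rewrite big_mkcond.
    rewrite exchange_big /= leq_sum // => x _; rewrite -big_mkcond sum_nat_const mulnC.
    rewrite leq_mul2r; apply/orP; right; apply: subset_leq_card; apply/subsetP=> w.
    rewrite inE => /andP[wx xs]; apply: WP => //; apply/existsP; exists w.
    by rewrite selfA.
  (* The edges entering [A b] are as many as those leaving it; these end in [W b], at most [d z] of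
     them at each [z]. *)
  have upper : \sum_x cin x <= \sum_b \sum_(v in W b) d v.
    rewrite exchange_big /= leq_sum // => b _.
    have -> : \sum_x \sum_(w | w \notin A b) (x \in A b) * e w x =
              \sum_(x in A b) \sum_(w | w \notin A b) e w x.
      rewrite [RHS]big_mkcond; apply: eq_bigr => x _.
      case: (x \in A b); last by rewrite big1.
      by apply: eq_bigr => w _; rewrite mul1n.
    rewrite balanced_cut exchange_big /=.
    rewrite big_mkcond [leqRHS]big_mkcond leq_sum // => z _.
    case: ifP => // zA; case: ifP => [zW|zW].
      rewrite /d bal_e indeg_sum big_mkcond leq_sum // => v _.
      by case: ifP.
    by rewrite big1 // => v vA; apply/eqP; rewrite eqb0; apply: contraFN zW => /outA ->.
  have lower2 x : #|O x| ^ 2 <= 2 * cin x.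
    have xO : x \notin O x by rewrite inE irr_e.
    have inA w : w \in O x -> x \in A w.
      by rewrite inE => /andP[wx]; apply: stepA wx.
    have antiA b w : b \in A w -> w \in A b -> b = w.
      by move=> bw wb; apply: antiI (AI _ _ bw) (AI _ _ wb); rewrite in_setT.
    pose S := \sum_(b in O x) \sum_(w in O x) (w \notin A b).
    (* Besides the [b] in [O x], the choice [b = x] contributes all of [O x] to [cin x]; this pays
       for the diagonal pairs in the next bound. *)
    have leS : S + #|O x| <= cin x.
      rewrite addnC -sum1_card.
      have -> : \sum_(w in O x) 1 = \sum_(w in O x) (w \notin A x).
        apply: eq_bigr => w wO; apply/esym/eqP; rewrite eqb1.
        by apply: contraNN xO => wA; move: (wO); rewrite (antiA w x wA (inA w wO)).
      rewrite /S -(big_setU1 _ (F := fun b => \sum_(w in O x) (w \notin A b)) xO) /cin /=.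
      rewrite big_mkcond leq_sum // => b _; case: ifP => // bxO.
      have xA : x \in A b.
        by move: bxO; rewrite in_setU1 => /orP[/eqP->|/inA].
      rewrite big_mkcond [leqRHS]big_mkcond leq_sum // => w _; rewrite xA mul1n.
      by rewrite [w \in O x]inE; case: (w \in A b); case: (e w x); case: (x \in s w).
    (* By antisymmetry each off-diagonal pair of [O x] counts at least once in [2 * S]; the diagonal
       accounts for the extra [#|O x|]. *)
    have leSS : #|O x| ^ 2 <= 2 * S + #|O x|.
      have -> : 2 * S = \sum_(b in O x) \sum_(w in O x) ((w \notin A b) + (b \notin A w)).
        rewrite mul2n -addnn {2}/S exchange_big -big_split.
        by apply: eq_bigr => b _; rewrite big_split.
      rewrite -mulnn -sum_nat_const -[X in _ + X]sum1_card -big_split.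
      apply: leq_sum => b bO /=; rewrite -sum1_card (bigD1 b bO) [X in X + 1](bigD1 b bO) /=.
      rewrite addnC leq_add2r (leq_trans _ (leq_addl _ _)) // leq_sum // => w /andP[_ nwb].
      rewrite addn_gt0 !lt0b -negb_and; apply: contraNN nwb => /andP[wb bw].
      by rewrite (antiA w b).
    lia.
  have -> : \sum_v outdeg e v ^ 2 = \sum_x d x ^ 2 by [].
  (* With d = k + r, d^2 = k^2 + 2kr + r^2 is at most 2dk + r^2. *)
  have : \sum_x d x ^ 2 <= \sum_x (2 * (d x * k x) + 2 * cin x).
    apply: leq_sum => x _; have := lower2 x; rewrite dE; nia.
  rewrite big_split /= -!big_distrr /= => h.
  by apply: leq_trans h _; rewrite (mulnDl 2 2) leq_add // leq_mul2l.
Qed.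
End HeavyCycle.

(** * Removing a cycle *)

Section Decomposition.
Variable T : finType.
Implicit Types (e : rel T) (c : seq T).

Definition sum_sqr_deg e := \sum_v outdeg e v ^ 2.

(** Averaging over [b]: some [W b] carries the required weight, and a positive left side makes that
    [W b] nonempty, hence dominated by a cycle. *)
Lemma heavy_dicycle e : irreflexive e -> (forall v, outdeg e v = indeg e v) ->
  0 < sum_sqr_deg e ->
  exists2 c, is_dicycle e c & sum_sqr_deg e <= 4 * #|T| * \sum_(v in c) outdeg e v.
Proof.
move=> irr_e bal_e pos; have [W [W_dicycle leW]] := sum_sqr_outdeg_le irr_e bal_e.
pose w b := \sum_(v in W b) outdeg e v.
have [/existsP[b hb]|] := boolP [exists b, sum_sqr_deg e <= 4 * #|T| * w b].
  have [|c cyc lec] := W_dicycle b.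
    by apply: contraTneq hb; rewrite /w => ->; rewrite big_pred0 // muln0 -ltnNge.
  by exists c => //; rewrite (leq_trans hb) // leq_mul2l lec orbT.
rewrite negb_exists => /forallP small; exfalso.
have T0 : 0 < #|T|.
  rewrite lt0n; apply: contraTneq pos => /card0_eq T0.
  by rewrite /sum_sqr_deg big_pred0.
have : \sum_(b : T) (4 * #|T| * w b).+1 <= \sum_(b : T) sum_sqr_deg e.
  by apply: leq_sum => b _; rewrite ltnNge.
rewrite sum_nat_const; under eq_bigr do rewrite -addn1.
rewrite big_split /= sum1_card -big_distrr /= => h.
have := leq_mul (leqnn #|T|) leW; rewrite -[\sum_v _ ^ 2]/(sum_sqr_deg e).
move: h T0; rewrite -/w -[#|xpredT|]/#|T|.
by move: #|T| (\sum_b w b) (sum_sqr_deg e) => n X Y; nia.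
Qed.

Definition remove_cycle e c := [rel x y | e x y && ((x, y) \notin cycle_edges c)].

Lemma cycle_edgesP c x y : reflect (x \in c /\ y = next c x) ((x, y) \in cycle_edges c).
Proof.
apply: (iffP imsetP) => [[z zc [-> ->]] //|[xc ->]]; by exists x.
Qed.

Lemma cycle_edges_sub e c : is_dicycle e c -> cycle_edges c \subset edges e.
Proof.
case=> _ /andP[cyc _]; apply/subsetP=> -[x y] /cycle_edgesP[xc ->].
by rewrite inE /= next_cycle.
Qed.

Lemma outdeg_remove_cycle e c v : is_dicycle e c ->
  outdeg e v = outdeg (remove_cycle e c) v + (v \in c).
Proof.
case=> _ /andP[cyc uc]; rewrite /outdeg; have [vc|vc] := boolP (v \in c).
  rewrite (cardsD1 (next c v)) inE next_cycle // addnC; congr (_ + _); apply: eq_card => w.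
  rewrite !inE andbC; congr (_ && ~~ _); apply/eqP/idP => [->|/cycle_edgesP[]//].
  exact/cycle_edgesP.
rewrite addn0; apply: eq_card => w; rewrite !inE /=; case: (cycle_edgesP c v w) => [[]|_].
  by rewrite (negPf vc).
by rewrite andbT.
Qed.

Lemma indeg_remove_cycle e c v : is_dicycle e c ->
  indeg e v = indeg (remove_cycle e c) v + (v \in c).
Proof.
case=> _ /andP[cyc uc]; rewrite /indeg; have [vc|vc] := boolP (v \in c).
  rewrite (cardsD1 (prev c v)) inE prev_cycle // addnC; congr (_ + _); apply: eq_card => w.
  rewrite !inE andbC; congr (_ && ~~ _); apply/eqP/idP => [->|/cycle_edgesP[_ ->]].
    by apply/cycle_edgesP; rewrite mem_prev next_prev.
  by rewrite prev_next.
rewrite addn0; apply: eq_card => w; rewrite !inE /=; case: (cycle_edgesP c w v) => [[wc vE]|_].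
  by rewrite vE mem_next wc in vc.
by rewrite andbT.
Qed.

Lemma cycle_decomposition_cons e c D : is_dicycle e c ->
  cycle_decomposition (remove_cycle e c) D -> cycle_decomposition e (c :: D).
Proof.
move=> ec [cycD disjD unionD]; split=> [c'| |].
- rewrite inE => /orP[/eqP->//|/cycD[c'0 /andP[cyc' uc']]]; split=> //.
  by rewrite /ucycle uc' andbT; apply: sub_cycle cyc' => x y /andP[].
- rewrite /= disjD andbT; apply/allP=> c' /cycD/cycle_edges_sub/subsetP sub.
  rewrite disjoint_sym disjoint_subset; apply/subsetP=> -[x y] /sub.
  by rewrite !inE => /andP[].
- rewrite big_cons unionD; apply/setP=> -[x y]; rewrite in_setU [in RHS]inE /=.
  have [/(subsetP (cycle_edges_sub ec))|xy] := boolP ((x, y) \in cycle_edges c).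
    by rewrite inE => ->.
  by rewrite inE /= xy andbT.
Qed.

(** A vertex of the cycle drops from degree d >= 1 to d - 1, and d^2 - (d - 1)^2 = 2d - 1 >= d. *)
Lemma sum_sqr_deg_remove_cycle e c : is_dicycle e c ->
  sum_sqr_deg (remove_cycle e c) + \sum_(v in c) outdeg e v <= sum_sqr_deg e.
Proof.
move=> ec; rewrite [X in _ + X]big_mkcond -big_split leq_sum // => v _ /=.
have := outdeg_remove_cycle v ec; case: (v \in c) => ->; nia.
Qed.

End Decomposition.

(** * Counting cycles with a logarithmic potential *)

Import Order.TTheory GRing.Theory Num.Theory.
Local Open Scope ring_scope.

(** This is ln x <= x - 1 at x = b / a. *)
Lemma ln_sub_ge (R : realType) (a b : R) : 0 < b -> 0 < a -> (a - b) / a <= ln a - ln b.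
Proof.
move=> b0 a0; rewrite -lerN2 opprB -ln_div ?posrE //.
have -> : b / a = 1 + - ((a - b) / a) by field; rewrite gt_eqF.
apply: le_ln1Dx; rewrite ltrNr opprK ltr_pdivrMr // mul1r; lra.
Qed.

(** Heavy cycles are removed greedily, by induction on [sum_sqr_deg e]; removal preserves balance.
    Each cycle is paid for by a drop of the potential ln(n + Phi) - ln n, which is 0 once no edge is
    left. *)
Lemma balanced_decomposition (R : realType) (T : finType) (e : rel T) :
  irreflexive e -> (forall v, outdeg e v = indeg e v) ->
  exists D, cycle_decomposition e D /\
    (size D)%:R <= 5 * #|T|%:R * (ln (#|T| + sum_sqr_deg e)%:R - ln #|T|%:R) :> R.
Proof.
have [k] := ubnP (sum_sqr_deg e); elim: k e => // k IHk e leek irr_e bal_e.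
have [e0|pos] := posnP (sum_sqr_deg e).
  exists [::]; rewrite e0 addn0 subrr mulr0 lexx; split=> //; split=> //.
  rewrite big_nil; apply/setP=> -[x y]; rewrite !inE /=; apply/esym/negP=> xy.
  move/eqP: e0; rewrite sum_nat_eq0 => /forallP/(_ x)/=.
  by rewrite expn_eq0 /= andbT cards_eq0 => /eqP/setP/(_ y); rewrite !inE xy.
have [c ec heavy] := heavy_dicycle irr_e bal_e pos.
pose t := (\sum_(v in c) outdeg e v)%N.
have n0 : (0 < #|T|)%N by move: (leq_trans pos heavy); rewrite !muln_gt0 => /andP[].
have t0 : (0 < t)%N by move: (leq_trans pos heavy); rewrite muln_gt0 => /andP[].
have drop := sum_sqr_deg_remove_cycle ec; rewrite -/t in drop heavy.
have [||v|D [decD sizeD]] := IHk (remove_cycle e c).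
- by rewrite -ltnS; apply: leq_trans leek; lia.
- by move=> x; rewrite /= irr_e.
- by apply: (@addIn (v \in c)); rewrite -outdeg_remove_cycle // -indeg_remove_cycle.
exists (c :: D); split; first exact: cycle_decomposition_cons.
set n := #|T| in n0 heavy sizeD *; set P := sum_sqr_deg e in drop heavy *.
set P' := sum_sqr_deg _ in drop sizeD.
have a0 : 0 < (n + P)%:R :> R by rewrite ltr0n; lia.
have b0 : 0 < (n + P')%:R :> R by rewrite ltr0n; lia.
have := ln_sub_ge b0 a0.
(* The 5 comes from n + P <= nt + 4nt with t >= 1, while P - P' >= t. *)
have : 1 <= 5 * n%:R * (((n + P)%:R - (n + P')%:R) / (n + P)%:R) :> R.
  rewrite mulrA ler_pdivlMr // mul1r -natrB; last by lia.
  by rewrite -[5]/(5%:R) -!natrM ler_nat; nia.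
have n0R : 0 <= 5 * n%:R :> R by rewrite mulr_ge0.
move=> h1 h2; have := ler_wpM2l n0R h2; rewrite /= -natr1; nra.
Qed.

(* The degree is replaced by 2 when it is at most 1: for a single directed cycle
   it is 1, whose logarithm is 0, although one cycle is needed. *)
Theorem theorem1p8 (R : realType) :
  exists C : R,
    forall (T : finType) (e : rel T),
      irreflexive e -> eulerian e ->
      exists D : seq (seq T),
        cycle_decomposition e D /\
        (size D)%:R <= C * #|T|%:R * ln (maxn 2 (max_degree e))%:R.
Proof.
(* 15 = 5 * 3, the 3 being the exponent of [M] in [leP]. *)
exists 15 => T e irr_e [_ bal_e].
have [D [decD sizeD]] := balanced_decomposition R irr_e bal_e.
exists D; split=> //; apply: le_trans sizeD _.
set M := maxn 2 _; have M2 : (2 <= M)%N by rewrite leq_maxl.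
have [n0|n0] := posnP #|T|; first by rewrite n0 !(mulr0, mul0r).
have leM v : (outdeg e v <= M)%N.
  rewrite (leq_trans _ (leq_maxr _ _)) // /max_degree.
  by rewrite (leq_trans (leq_maxr (indeg e v) _)) // (leq_bigmax v).
(* Here [M >= 2] is used: it gives 1 + M^2 <= M^3. *)
have leP : (#|T| + sum_sqr_deg e <= #|T| * M ^ 3)%N.
  apply: (@leq_trans (\sum_(v : T) (1 + M ^ 2))%N).
    rewrite big_split /= sum1_card leq_add2l leq_sum // => v _.
    by rewrite leq_exp2r.
  by rewrite sum_nat_const leq_mul2l !expnS expn0; apply/orP; right; nia.
have M0 : 0 < M%:R :> R by rewrite ltr0n; lia.
have nR : 0 < #|T|%:R :> R by rewrite ltr0n.
have : ln (#|T| + sum_sqr_deg e)%:R <= ln #|T|%:R + 3 * ln M%:R :> R.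
  rewrite mulr_natl -lnXn // -lnM ?posrE ?exprn_gt0 // ler_ln ?posrE.
  - by rewrite -natrX -natrM ler_nat.
  - by rewrite ltr0n addn_gt0 n0.
  - by rewrite mulr_gt0 ?exprn_gt0.
move=> h; rewrite -lerBlDl in h.
by apply: le_trans (ler_wpM2l _ h) _; [rewrite mulr_ge0 // ltW | nra].
Qed.
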